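(* Let $\epsilon\in(0,1)$ be the teleport probability and $R\ge 1$ the number of walks stored per node. For every integer branching factor $d\ge 2$ with $H_d(1-\epsilon)>1$, where $H_d=\sum_{j=1}^d \frac{1}{j}$ is the $d$th harmonic number, there is a family of directed graphs, with $n$ nodes and $m=n-1$ edges for arbitrarily large $n$, and an arrival order of their edges, such that when the incremental Monte Carlo PageRank algorithm described in the context processes the $m$ edge arrivals, the expected total number of walk segments updated is \[\Omega\left(R\, n\, m^{\log_d\left(H_d(1-\epsilon)\right)}\right).\]
   Context: Incremental Monte Carlo PageRank (Bahmani–Chowdhury–Goel). All $n$ nodes of a directed graph are present from the start; the $m$ edges arrive one at a time in an order fixed in advance (here chosen by an adversary). The algorithm maintains, for every node, $R$ random walks starting at that node, generated as follows: after each step the walk terminates with probability $\epsilon$ (the teleport probability), so its length is geometric with mean $1/\epsilon$; with the remaining probability $1-\epsilon$ it moves to an out-neighbor of the current node chosen uniformly at random among the out-neighbors present in the current graph; if the current node has out-degree $0$, the walk instead moves back to its starting node and continues from there. When a new edge $(u,v)$ arrives, let $d(u)$ be the new out-degree of $u$. For each stored walk passing through $u$, independently with probability $1/d(u)$, the part of the walk after $u$ is discarded and a new remainder is generated starting at $v$ (with the same rule), preserving the total length of the original walk; each such regeneration counts as one updated walk segment. The quantity bounded is the expected total number of updated walk segments over all $m$ arrivals. The constant in $\Omega$ may depend on $\epsilon$ and $d$. *)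

(* Defs.v *)
From HB Require Import structures.
From mathcomp Require Import all_boot all_order all_algebra.
From mathcomp Require Import all_classical all_reals all_analysis.

Set Implicit Arguments.
Unset Strict Implicit.
Unset Printing Implicit Defensive.
Import Order.TTheory GRing.Theory Num.Theory.
Local Open Scope ring_scope.

(* Finitely supported distributions, as lists of (weight, outcome) pairs; the
   same outcome may occur several times, its weights then add up. *)
Section Dist.
Variable K : realType.

Definition dist (T : Type) : Type := seq (K * T).

Definition dret (T : Type) (x : T) : dist T := [:: (1, x)].

Definition dbind (T U : Type) (p : dist T) (f : T -> dist U) : dist U :=
  [seq (a.1 * b.1, b.2) | a <- p, b <- f a.2].

Definition coin (p : K) : dist bool := [:: (p, true); (1 - p, false)].

Definition uniform (T : Type) (s : seq T) : dist T :=
  [seq ((size s)%:R^-1, x) | x <- s].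

Definition prob (T : eqType) (p : dist T) (x : T) : K :=
  \sum_(a <- p | a.2 == x) a.1.

Definition expect (T : Type) (p : dist T) (f : T -> K) : K :=
  \sum_(a <- p) a.1 * f a.2.

End Dist.

(* How the coins of bias 1/d(u) are attached to a stored walk that visits u
   more than once: either a single coin for the walk, which decides whether the
   part after its first visit is discarded, or a fresh coin for each successive
   visit until one of them succeeds. Both give at most one regeneration per walk
   and per arrival, and they coincide on walks that pass through u once. *)
Variant coin_rule := PerWalk | PerVisit.

Section IncrementalPageRank.
Variables (K : realType) (V : finType).

(* The current graph is given by the list of the edges that have arrived. *)
Implicit Types (g : seq (V * V)) (e : V * V) (w : seq V) (x y : V).

Definition out_nbrs g y : seq V := [seq e.2 | e <- g & e.1 == y].

Definition out_deg g y : nat := size (out_nbrs g y).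

(* One move from y of a walk that started at x. *)
Definition next g x y : dist K V :=
  if out_deg g y == 0%N then dret K x else uniform K (out_nbrs g y).

(* The k nodes that follow y in a walk that started at x. *)
Fixpoint moves g x y (k : nat) : dist K (seq V) :=
  if k is k'.+1 then
    dbind (next g x y) (fun z =>
    dbind (moves g x z k') (fun t => dret K (z :: t)))
  else dret K [::].

(* Probability that a walk started at x and now at y visits exactly the nodes
   t from here on and then terminates. *)
Fixpoint tail_law (eps : K) g x y (t : seq V) : K :=
  if t is z :: t' then
    (1 - eps) * prob (next g x y) z * tail_law eps g x z t'
  else eps.

(* A walk is the list of the nodes it visits, starting node included; its
   length, size w, is thus geometric on {1, 2, ...} with mean 1/eps. *)
Definition walk_law (eps : K) g x w : K :=
  if w is y :: t then (y == x)%:R * tail_law eps g x x t else 0.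

(* The last position is left out: a walk that ends at u has no part after u. *)
Definition visits w u : seq nat :=
  [seq i <- iota 0 (size w).-1 | nth u w i == u].

Fixpoint choose_visit (rule : coin_rule) (p : K) (s : seq nat) :
    dist K (option nat) :=
  if s is i :: s' then
    dbind (coin p) (fun b =>
      if b then dret K (Some i)
      else if rule is PerVisit then choose_visit rule p s' else dret K None)
  else dret K None.

(* Effect of the arrival of e on one stored walk w started at x, where g already
   contains e; the boolean tells whether w was regenerated. *)
Definition update_walk (rule : coin_rule) g e x w : dist K (seq V * bool) :=
  dbind (choose_visit rule (out_deg g e.1)%:R^-1 (visits w e.1)) (fun c =>
    if c is Some i then
      dbind (moves g x e.2 (size w - i.+2)%N) (fun t =>
        dret K (take i.+1 w ++ e.2 :: t, true))
    else dret K (w, false)).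

(* The walks stored by the algorithm: s (x, i) is the i-th walk from x. *)
Definition store (R : nat) := {ffun V * 'I_R -> seq V}.

Definition update_store (R : nat) (rule : coin_rule) g e (s : store R) :
    dist K (store R * nat) :=
  foldr (fun k (acc : dist K (store R * nat)) =>
      dbind acc (fun sc =>
      dbind (update_walk rule g e k.1 (sc.1 k)) (fun wb =>
        dret K ([ffun j => if j == k then wb.1 else sc.1 j] : store R,
                (sc.2 + wb.2)%N))))
    (dret K (s, 0%N)) (enum {: V * 'I_R}).

(* Total number of regenerations while the edges es arrive after those of g. *)
Fixpoint run (R : nat) (rule : coin_rule) g (es : seq (V * V)) (s : store R) :
    dist K nat :=
  if es is e :: es' then
    dbind (update_store rule (e :: g) e s) (fun sc =>
    dbind (run rule (e :: g) es' sc.1) (fun c => dret K (sc.2 + c)%N))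
  else dret K 0%N.

Definition store_law (R : nat) (eps : K) g (s : store R) : K :=
  \prod_(k : V * 'I_R) walk_law eps g k.1 (s k).

Definition expected_updates (R : nat) (rule : coin_rule) (eps : K)
    (es : seq (V * V)) : \bar K :=
  (\esum_(s in [set: store R])
     (store_law eps [::] s * expect (run rule [::] es s) (fun c => c%:R))%:E)%E.

Definition loopless (G : {set V * V}) : bool := [forall x, (x, x) \notin G].

Definition arrival_order (G : {set V * V}) (es : seq (V * V)) : bool :=
  perm_eq es (enum G).

End IncrementalPageRank.

Definition harmonic_number (K : realType) (d : nat) : K :=
  \sum_(1 <= j < d.+1) j%:R^-1.

Definition logb (K : realType) (b x : K) : K := ln x / ln b.

(* Main.v *)
Require Import Defs.
From HB Require Import structures.
From mathcomp Require Import all_boot all_order all_algebra.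
From mathcomp Require Import all_classical all_reals all_analysis.
From mathcomp Require Import ring lra zify.

Set Implicit Arguments.
Unset Strict Implicit.
Unset Printing Implicit Defensive.
Import Order.TTheory GRing.Theory Num.Theory.
Import numFieldNormedType.Exports.
Local Open Scope ring_scope.

(* The graph is a complete d-ary tree of height h, with edges from parents to
   children, together with as many further nodes, each of which sends one edge to
   the root. The edges into the root arrive first, then those of the tree in
   depth-first order, so that every subtree is completed before the next sibling
   is attached.

   Consider a walk of more than h + 1 nodes that starts outside the tree. While
   the subtree of u is built, the beginning of the walk up to its first visit to
   u is never touched, since all the regenerations happen after it. When the j-th
   child of u arrives, a walk whose beginning is the path to u is rerouted to that
   child with probability at least 1/j, and then meets the whole construction of
   the subtree of the child. Its expected number of updates is therefore at least
   H_d (1 + H_d (1 + ...)) >= H_d^h. A walk is long enough with probability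
   (1 - eps)^(h+1), and d^h is of the order of the number of edges. *)

(** * Expectations over finitely supported distributions *)

Section Expect.
Variable K : realType.

Lemma expect_dret (T : Type) (x : T) (f : T -> K) : expect (dret K x) f = f x.
Proof. by rewrite /expect /dret big_seq1 mul1r. Qed.

Lemma expect_dbind (T U : Type) (p : dist K T) (q : T -> dist K U) (f : U -> K) :
  expect (dbind p q) f = expect p (fun x => expect (q x) f).
Proof.
rewrite /expect /dbind big_allpairs_dep; apply: eq_bigr => a _.
by rewrite big_distrr; apply: eq_bigr => b _ /=; rewrite mulrA.
Qed.

Lemma expect_coin (p : K) (f : bool -> K) :
  expect (coin p) f = p * f true + (1 - p) * f false.
Proof. by rewrite /expect /coin big_cons big_seq1. Qed.

Lemma expectD (T : Type) (p : dist K T) (f g : T -> K) :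
  expect p (fun x => f x + g x) = expect p f + expect p g.
Proof. by rewrite /expect -big_split; apply: eq_bigr => a _; rewrite mulrDr. Qed.

Lemma expectZ (T : Type) (p : dist K T) (k : K) (f : T -> K) :
  expect p (fun x => k * f x) = k * expect p f.
Proof. by rewrite /expect big_distrr; apply: eq_bigr => a _; rewrite mulrCA. Qed.

Lemma eq_expect (T : Type) (p : dist K T) (f g : T -> K) :
  f =1 g -> expect p f = expect p g.
Proof. by move=> fg; apply: eq_bigr => a _; rewrite fg. Qed.

(* p is a probability distribution concentrated on Q; the second clause says
   both that weights are nonnegative and that outcomes outside Q have none. *)
Definition law_on (T : Type) (Q : T -> Prop) (p : dist K T) : Prop :=
  expect p (fun=> 1) = 1 /\
  forall f : T -> K, (forall x, Q x -> 0 <= f x) -> 0 <= expect p f.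

Lemma expect_cst (T : Type) (Q : T -> Prop) (p : dist K T) (k : K) :
  law_on Q p -> expect p (fun=> k) = k.
Proof.
case=> p1 _; rewrite -[RHS]mulr1 -p1 -expectZ.
by apply: eq_expect => x; rewrite mulr1.
Qed.

Lemma le_expect (T : Type) (Q : T -> Prop) (p : dist K T) (f g : T -> K) :
  law_on Q p -> (forall x, Q x -> f x <= g x) -> expect p f <= expect p g.
Proof.
case=> _ p0 fg; rewrite -subr_ge0 -mulN1r -expectZ -expectD.
by apply: p0 => x Qx; rewrite mulN1r subr_ge0 fg.
Qed.

Lemma expect_ge (T : Type) (Q : T -> Prop) (p : dist K T) (k : K) (f : T -> K) :
  law_on Q p -> (forall x, Q x -> k <= f x) -> k <= expect p f.
Proof. by move=> lp fk; rewrite -(expect_cst k lp); apply: le_expect lp _. Qed.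

Lemma law_on_dret (T : Type) (Q : T -> Prop) (x : T) :
  Q x -> law_on Q (dret K x).
Proof. by move=> Qx; split=> [|f f0]; rewrite expect_dret //; apply: f0. Qed.

Lemma law_on_dbind (T U : Type) (Q : T -> Prop) (Q' : U -> Prop)
    (p : dist K T) (q : T -> dist K U) :
  law_on Q p -> (forall x, Q x -> law_on Q' (q x)) -> law_on Q' (dbind p q).
Proof.
move=> lp lq; split=> [|f f0]; rewrite expect_dbind; last first.
  by case: lp => _; apply=> x /lq [_]; apply.
rewrite -[RHS](expect_cst 1 lp).
by apply/eqP; rewrite eq_le; apply/andP; split; apply: le_expect lp _ => x /lq [-> _].
Qed.

Lemma law_on_coin (p : K) : 0 <= p <= 1 -> law_on xpredT (coin p).
Proof.
case/andP=> p0 p1; split=> [|f f0]; rewrite expect_coin; first by ring.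
by rewrite addr_ge0 ?mulr_ge0 ?subr_ge0 ?f0.
Qed.

Lemma law_on_uniform (T : Type) (s : seq T) :
  size s != 0%N -> law_on xpredT (uniform K s).
Proof.
move=> s0; split=> [|f f0]; rewrite /expect /uniform big_map /=.
  by rewrite big_const_seq count_predT iter_addr_0 mulr1 -[LHS]mulr_natr mulVf ?pnatr_eq0.
by apply: sumr_ge0 => x _; rewrite mulr_ge0 ?invr_ge0 ?ler0n ?f0.
Qed.

End Expect.

(** * Updates of a single stored walk, and reduction of the store to single walks *)

Section Walk.
Variables (K : realType) (V : finType).
Implicit Types (g es : seq (V * V)) (e : V * V) (w p : seq V) (x y u v : V).
Implicit Types (rule : coin_rule).

Lemma natV_itv (j : nat) : 0 <= (j%:R^-1 : K) <= 1.
Proof.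
by case: j => [|j]; rewrite ?invr0 ?lexx ?ler01 // invr_ge0 ler0n invf_le1 // ler1n.
Qed.

Lemma law_on_next g x y : law_on xpredT (Defs.next K g x y).
Proof.
by rewrite /Defs.next; case: ifPn => [_|]; [exact: law_on_dret|exact: law_on_uniform].
Qed.

Lemma law_on_moves g x y k : law_on (fun t => size t = k) (moves K g x y k).
Proof.
elim: k y => [|k IHk] y /=; first exact: law_on_dret.
apply: law_on_dbind (law_on_next g x y) _ => z _.
by apply: law_on_dbind (IHk z) _ => t tk; apply: law_on_dret; rewrite /= tk.
Qed.

Lemma law_on_choose_visit rule (q : K) (s : seq nat) : 0 <= q <= 1 ->
  law_on (fun c => if c is Some i then i \in s else True)
         (choose_visit rule q s).
Proof.
move=> q01; elim: s => [|i s IHs] /=; first exact: law_on_dret.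
apply: law_on_dbind (law_on_coin q01) _ => -[] _.
  by apply: law_on_dret; rewrite mem_head.
case: rule IHs => IHs; first exact: law_on_dret.
split=> [|f f0]; first by case: IHs.
case: IHs => _; apply=> -[i'|] // i's; apply: f0 => //.
by rewrite in_cons i's orbT.
Qed.

Lemma visits_prefix p w u i :
  prefix p w -> u \notin p -> i \in visits w u ->
  (size p <= i)%N && (i.+1 < size w)%N.
Proof.
case/prefixP=> t -> up; rewrite mem_filter mem_iota nth_cat => /andP[].
case: ltnP => [ip /eqP ui|pi _ iw]; last by apply/andP; split; lia.
by case/negP: up; rewrite -ui mem_nth.
Qed.

Lemma visits_first p w u :
  prefix (rcons p u) w -> u \notin p -> ((size p).+1 < size w)%N ->
  exists s, visits w u = size p :: s /\
            forall i, i \in s -> (size p < i)%N && (i.+1 < size w)%N.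
Proof.
move=> /prefixP pw up; have [t ->] : exists t : seq V, w = rcons p u ++ t := pw.
rewrite size_cat size_rcons => tn.
have -> : visits (rcons p u ++ t) u =
    size p :: [seq i <- iota (size p).+1 (size t).-1 |
                 nth u (rcons p u ++ t) i == u].
  rewrite /visits size_cat size_rcons.
  have -> : (((size p).+1 + size t).-1 = size p + (size t).-1.+1)%N by lia.
  rewrite iotaD filter_cat add0n /= nth_cat size_rcons ltnSn nth_rcons ltnn eqxx.
  rewrite eqxx (eq_in_filter (a2 := pred0)) ?filter_pred0 // => i.
  rewrite mem_iota /= => ip; rewrite nth_cat size_rcons ltnS (ltnW ip).
  rewrite nth_rcons ip; apply/negbTE; apply: contraNneq up => <-.
  exact: mem_nth.
eexists; split=> // i; rewrite mem_filter mem_iota => /andP[_ /andP[pi it]].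
by rewrite pi /=; lia.
Qed.

Lemma law_on_regenerate g x v w p (i : nat) :
  prefix p w -> (size p <= i.+1)%N -> (i.+1 < size w)%N ->
  law_on (fun wb : seq V * bool =>
            [/\ prefix (take i.+1 w ++ [:: v]) wb.1, prefix p wb.1,
                size wb.1 = size w & wb.2])
    (dbind (moves K g x v (size w - i.+2)%N) (fun t =>
       dret K (take i.+1 w ++ v :: t, true))).
Proof.
move=> pw pi iw; apply: law_on_dbind (law_on_moves g x v _) _ => t tk.
apply: law_on_dret; split=> //=.
- by rewrite -[v :: t]cat1s catA prefix_prefix.
- case/prefixP: pw => w' ->; rewrite take_cat ltnNge.
  case: (ltngtP i.+1 (size p)) pi => //= [_|->] _.
    by rewrite -catA prefix_prefix.
  by rewrite subnn take0 cats0 prefix_prefix.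
- by rewrite size_cat size_take iw /= tk; lia.
Qed.

Lemma law_on_update_walk rule g e x w p :
  prefix p w -> e.1 \notin p ->
  law_on (fun wb => prefix p wb.1 /\ size wb.1 = size w)
         (update_walk K rule g e x w).
Proof.
move=> pw ep.
apply: law_on_dbind (law_on_choose_visit rule _ (natV_itv _)) _ => -[i|] iw.
  have /andP[pi iw'] := visits_prefix pw ep iw.
  have [m1 m2] := law_on_regenerate g x e.2 pw (leqW pi) iw'.
  by split=> // f f0; apply: m2 => wb [_ ? ? _]; apply: f0.
exact: law_on_dret.
Qed.

(* The walk reaches u for the first time right after p, so under either coin
   rule the first coin tossed is the one of that visit. *)
Lemma expect_update_walk_ge rule g x w p u v (j : nat) (A B : K)
    (f : seq V * bool -> K) :
  prefix (rcons p u) w -> u \notin p -> ((size p).+1 < size w)%N ->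
  out_deg g u = j ->
  (forall w', prefix (rcons (rcons p u) v) w' -> size w' = size w ->
     A <= f (w', true)) ->
  (forall w' b, prefix (rcons p u) w' -> size w' = size w -> B <= f (w', b)) ->
  j%:R^-1 * A + (1 - j%:R^-1) * B <= expect (update_walk K rule g (u, v) x w) f.
Proof.
move=> pw up pn gj fA fB.
have [s [Es sP]] := visits_first pw up pn.
have /andP[q0 q1] := natV_itv j.
rewrite /update_walk expect_dbind Es /= gj expect_dbind expect_coin.
apply: lerD; apply: ler_wpM2l; rewrite ?subr_ge0 //.
  rewrite expect_dret.
  have := law_on_regenerate g x v pw (_ : size _ <= (size p).+1)%N pn.
  rewrite size_rcons => /(_ (leqnn _)) m; apply: expect_ge m _ => -[w' b] /= [+ _ ww' ->].
  case/prefixP: pw => t Ew; rewrite {1}Ew take_cat size_rcons ltnn subnn take0 cats0.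
  by rewrite cats1 => pw'; apply: fA.
have noneB : B <= f (w, false) by apply: fB.
case: rule; first by rewrite !expect_dret.
(* After the first coin fails, a later visit may still succeed; the cut then falls beyond
   [rcons p u], so [B] applies. *)
apply: expect_ge (law_on_choose_visit PerVisit s (natV_itv j)) _ => -[i|] is_.
  have /andP[pi iw] := sP _ is_.
  have m := law_on_regenerate g x v pw (_ : size _ <= i.+1)%N iw.
  by apply: expect_ge (m _) _ => [|[w' b] [_ ? ? _]]; [rewrite size_rcons; lia|apply: fB].
by rewrite expect_dret.
Qed.

(** The single-walk counterpart of [run]: by linearity of expectation, [expect_run] recovers the
    total from it without following the walks jointly. *)
Fixpoint walk_updates rule g es x w : K :=
  if es is e :: es' then
    expect (update_walk K rule (e :: g) e x w)
      (fun wb => wb.2%:R + walk_updates rule (e :: g) es' x wb.1)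
  else 0.

Lemma walk_updates_ge0 rule g es x w : 0 <= walk_updates rule g es x w.
Proof.
elim: es g w => [|e es IHes] g w //=.
have := law_on_update_walk rule (e :: g) x (prefix0s w) (_ : e.1 \notin [::]).
by move=> /(_ isT) m; apply: expect_ge m _ => wb _; rewrite addr_ge0.
Qed.

(** Edges leaving nodes outside [p] can only cut a walk beyond [p], so its beginning and its length
    survive their arrival; the updates they cause are discarded as nonnegative. *)
Lemma walk_updates_skip rule g es1 es2 x w p (A : K) :
  (forall e, e \in es1 -> e.1 \notin p) -> prefix p w ->
  (forall w', prefix p w' -> size w' = size w ->
     A <= walk_updates rule (catrev es1 g) es2 x w') ->
  A <= walk_updates rule g (es1 ++ es2) x w.
Proof.
elim: es1 g w => [|e es1 IHes] g w es1p pw leA /=; first exact: leA.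
have m := law_on_update_walk rule (e :: g) x pw (es1p e (mem_head _ _)).
apply: expect_ge m _ => -[w' b] /= [pw' ww'].
rewrite -[A]add0r lerD ?ler0n //; apply: IHes => // [e' e'1|w'' pw'' ww''].
  by apply: es1p; rewrite in_cons e'1 orbT.
by apply: leA; rewrite // ww''.
Qed.

Lemma expect_update_store (R : nat) rule g e (s : store V R)
    (f : V * 'I_R -> seq V -> K) :
  expect (update_store K rule g e s)
    (fun sc => sc.2%:R + \sum_k f k (sc.1 k)) =
  \sum_k expect (update_walk K rule g e k.1 (s k))
           (fun wb => wb.2%:R + f k wb.1).
Proof.
(* Generalized for an induction on the list of walks processed: a walk outside the list is left as
   it is. *)
transitivity (\sum_k (if k \in enum {: V * 'I_R} then
    expect (update_walk K rule g e k.1 (s k)) (fun wb => wb.2%:R + f k wb.1)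
  else f k (s k))); last by apply: eq_bigr => k _; rewrite mem_enum.
rewrite /update_store; elim: (enum _) (enum_uniq {: V * 'I_R}) f => [_ f|k ks IHks].
  by rewrite expect_dret add0r.
rewrite cons_uniq => /andP[kks ks_uniq] f /=; rewrite expect_dbind.
(* The fold updates the walk [k] last, so the expectation over this update can be absorbed into the
   function before the induction hypothesis is used for [ks]. *)
pose f' j w : K := if j == k then
  expect (update_walk K rule g e k.1 w) (fun wb => wb.2%:R + f k wb.1) else f j w.
transitivity (expect (foldr (fun k (acc : dist K (store V R * nat)) =>
      dbind acc (fun sc =>
      dbind (update_walk K rule g e k.1 (sc.1 k)) (fun wb =>
        dret K ([ffun j => if j == k then wb.1 else sc.1 j] : store V R,
                (sc.2 + wb.2)%N)))) (dret K (s, 0%N)) ks)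
    (fun sc => sc.2%:R + \sum_j f' j (sc.1 j))).
  apply: eq_expect => -[t c] /=; rewrite expect_dbind.
  have m := law_on_update_walk rule g k.1 (prefix0s (t k)) (_ : e.1 \notin [::]).
  rewrite [in RHS](bigD1 k) //= /f' eqxx.
  rewrite (eq_bigr (fun j => f j (t j))) => [|j /negbTE ->] //.
  set S := \sum_(j | _) _.
  transitivity (expect (update_walk K rule g e k.1 (t k))
      (fun wb => (c%:R + S) + (wb.2%:R + f k wb.1))).
    apply: eq_expect => -[w b]; rewrite expect_dret /= (bigD1 k) //= ffunE eqxx.
    rewrite (eq_bigr (fun j => f j (t j))) => [|j /negbTE jk]; last by rewrite ffunE jk.
    by rewrite -/S natrD; ring.
  by rewrite expectD (expect_cst _ (m isT)); ring.
rewrite (IHks ks_uniq f'); apply: eq_bigr => j _; rewrite in_cons /f'.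
by case: eqVneq => [->|jk] //=; rewrite (negbTE kks).
Qed.

Lemma expect_run (R : nat) rule g es (s : store V R) :
  expect (run K rule g es s) (fun c => c%:R) =
  \sum_k walk_updates rule g es k.1 (s k).
Proof.
elim: es g s => [|e es IHes] g s /=; first by rewrite expect_dret big1.
rewrite -(expect_update_store rule (e :: g) e s
  (fun k w => walk_updates rule (e :: g) es k.1 w)).
rewrite expect_dbind; apply: eq_expect => -[t c] /=.
rewrite expect_dbind -IHes.
transitivity (expect (run K rule (e :: g) es t) (fun c' => c%:R * 1 + c'%:R)).
  by apply: eq_expect => c'; rewrite expect_dret natrD mulr1.
rewrite expectD expectZ; congr (_ + _).
(* The count [c] already reached comes out of the expectation because [run] has total mass 1. *)
suff [-> _] : law_on xpredT (run K rule (e :: g) es t) by rewrite mulr1.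
elim: es (e :: g) t {IHes} => [|e' es IHes] g' t /=; first exact: law_on_dret.
apply: (law_on_dbind (Q := xpredT)) => [|sc _]; last first.
  by apply: law_on_dbind (IHes _ _) _ => c' _; apply: law_on_dret.
rewrite /update_store; elim: (enum _) => [|k ks IHks] /=; first exact: law_on_dret.
apply: law_on_dbind IHks _ => sc _.
have m := law_on_update_walk rule (e' :: g') k.1 (prefix0s (sc.1 k)) (_ : e'.1 \notin [::]).
by apply: law_on_dbind (m isT) _ => wb _; apply: law_on_dret.
Qed.

End Walk.

(** * The complete d-ary tree and the order of its edges *)

Section Tree.
Variable d : nat.

Fixpoint tree_size (h : nat) : nat :=
  if h is h'.+1 then (d * tree_size h').+1 else 1%N.

(* The edges of the complete d-ary tree of height h with nodes b, b + 1, ...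
   numbered in preorder; they are listed in depth-first order, so that the
   subtree of each child is completed before the next child is attached. *)
Fixpoint tree_edges (h b : nat) : seq (nat * nat) :=
  if h is h'.+1 then
    flatten [seq (b, (b.+1 + j * tree_size h')%N) ::
                 tree_edges h' (b.+1 + j * tree_size h')%N | j <- iota 0 d]
  else [::].

Lemma tree_size_gt0 h : (0 < tree_size h)%N.
Proof. by case: h. Qed.

(** Depth-first order agrees with preorder numbering, so the heads come in increasing order. The
    number of edges and their distinctness follow from this. *)
Lemma heads_tree_edges h b :
  [seq e.2 | e <- tree_edges h b] = iota b.+1 (tree_size h).-1.
Proof.
elim: h b => [|h IHh] b //=.
(* Generalized to the [k] consecutive children from the [j]-th on. *)
suff H k j : [seq e.2 | e <- flatten [seq (b, (b.+1 + j * tree_size h)%N) ::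
                 tree_edges h (b.+1 + j * tree_size h)%N | j <- iota j k]] =
    iota (b.+1 + j * tree_size h)%N (k * tree_size h)%N.
  by rewrite H addn0.
elim: k j => [|k IHk] j //=.
rewrite map_cat IHh IHk.
have -> : (k.+1 * tree_size h = (tree_size h).-1.+1 + k * tree_size h)%N.
  by rewrite prednK ?tree_size_gt0.
rewrite iotaD /=; congr (_ :: _ ++ iota _ _).
by have := tree_size_gt0 h; rewrite mulSn; lia.
Qed.

Lemma tails_tree_edges h b e :
  e \in tree_edges h b -> (b <= e.1)%N && (e.1 < e.2)%N.
Proof.
elim: h b => [|h IHh] b //= /flatten_mapP[j _].
rewrite in_cons => /predU1P[->|/IHh] /=; first by rewrite leqnn; lia.
by move=> /andP[be ->]; rewrite andbT; lia.
Qed.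

Lemma tree_edges_bounds h b e : e \in tree_edges h b ->
  [/\ (b <= e.1)%N, (e.1 < e.2)%N & (e.2 < b + tree_size h)%N].
Proof.
move=> eb; have /andP[be ee] := tails_tree_edges eb; split=> //.
have := map_f snd eb; rewrite heads_tree_edges mem_iota.
by have := tree_size_gt0 h; lia.
Qed.

Lemma uniq_tree_edges h b : uniq (tree_edges h b).
Proof. by apply: (@map_uniq _ _ snd); rewrite heads_tree_edges iota_uniq. Qed.

Lemma size_tree_edges h b : size (tree_edges h b) = (tree_size h).-1.
Proof. by rewrite -(size_map snd) heads_tree_edges size_iota. Qed.

Lemma tree_size_ge h : (1 < d)%N -> (h < tree_size h)%N.
Proof. by move=> d1; elim: h => //= h IHh; nia. Qed.

Lemma tree_size_le h : (1 < d)%N -> (tree_size h < 2 * d ^ h)%N.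
Proof. by move=> d1; elim: h => //= h IHh; rewrite expnS; nia. Qed.

End Tree.

(** * Expected updates of a walk while a tree is built *)

Section WalkOnTree.
Variables (K : realType) (V : finType) (d n : nat) (phi : nat -> V).
Hypothesis phi_inj : forall i j, (i < n)%N -> (j < n)%N -> phi i = phi j -> i = j.
Implicit Types (g es : seq (V * V)) (w p : seq V) (x y : V).

Definition phi_edge (e : nat * nat) : V * V := (phi e.1, phi e.2).

Lemma out_deg_cons (e : V * V) g y : out_deg (e :: g) y = ((e.1 == y) + out_deg g y)%N.
Proof. by rewrite /out_deg /out_nbrs /=; case: eqP. Qed.

Lemma out_deg_catrev es g y :
  (forall e, e \in es -> e.1 != y) -> out_deg (catrev es g) y = out_deg g y.
Proof.
elim: es g => //= e es IHes g esy; rewrite IHes => [|e' e'es].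
  by rewrite out_deg_cons (negbTE (esy e _)) ?mem_head.
by apply: esy; rewrite in_cons e'es orbT.
Qed.

Lemma catrev_cat (T : Type) (s1 s2 s3 : seq T) :
  catrev (s1 ++ s2) s3 = catrev s2 (catrev s1 s3).
Proof. by elim: s1 s3 => //= x s1 IHs s3. Qed.

Fixpoint tree_updates (h : nat) : K :=
  if h is h'.+1 then harmonic_number K d * (1 + tree_updates h') else 0.

(* The continuation es is processed after the tree; A bounds its contribution
   for all the walks into which w may have been turned by then. *)
Lemma walk_updates_tree rule h b g es x w p (A : K) :
  (b + tree_size d h <= n)%N ->
  (forall i, (b <= i < b + tree_size d h)%N ->
     phi i \notin p /\ out_deg g (phi i) = 0%N) ->
  prefix (rcons p (phi b)) w -> (size p + h < size w)%N ->
  (forall w', prefix (rcons p (phi b)) w' -> size w' = size w ->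
     A <= walk_updates K rule (catrev [seq phi_edge e | e <- tree_edges d h b] g) es x w') ->
  tree_updates h + A <=
    walk_updates K rule g ([seq phi_edge e | e <- tree_edges d h b] ++ es) x w.
Proof.
elim: h b g es w p A => [|h IHh] b g es w p A bn fresh pw wn leA.
  by rewrite /= add0r; apply: leA.
have T0 := tree_size_gt0 d h; set T := tree_size d h in T0 bn fresh.
have bT : (b < b + tree_size d h.+1)%N by rewrite /= -/T; lia.
have [bp gb] : phi b \notin p /\ out_deg g (phi b) = 0%N by apply: fresh; rewrite leqnn.
(* [c j] is the root of the [j]-th child subtree, counted from 0, and [F j k] builds the [k]
   subtrees from that one on. *)
pose c j := (b.+1 + j * T)%N.
pose F j k := flatten [seq (b, c j) :: tree_edges d h (c j) | j <- iota j k].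
have FS j k : F j k.+1 = (b, c j) :: tree_edges d h (c j) ++ F j.+1 k by [].
have cS j : c j.+1 = (c j + T)%N by rewrite /c mulSn; lia.
have c_max j : (j < d)%N -> (c j + T <= b + tree_size d h.+1)%N.
  by move=> jd; rewrite /c /= -/T; nia.
(* Inner induction on the number [k] of children still to come. The out-degree [j] of the root fixes
   the bias 1/(j+1) of the next coin. *)
suff H k j g' w' : (j + k = d)%N -> out_deg g' (phi b) = j ->
    (forall i, (c j <= i < b + tree_size d h.+1)%N -> out_deg g' (phi i) = 0%N) ->
    prefix (rcons p (phi b)) w' -> size w' = size w ->
    (forall w', prefix (rcons p (phi b)) w' -> size w' = size w ->
       A <= walk_updates K rule (catrev [seq phi_edge e | e <- F j k] g') es x w') ->
    (\sum_(j <= i < d) i.+1%:R^-1) * (1 + tree_updates h) + A <=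
    walk_updates K rule g' ([seq phi_edge e | e <- F j k] ++ es) x w'.
  rewrite /= /harmonic_number big_add1; apply: H => // i ib.
  by case: (fresh i) => //; move: ib; rewrite /c mul0n addn0; lia.
elim: k j g' w' => [|k IHk] j g' w' jk g'b g'0 pw' ww'.
  by move=> leA'; rewrite addn0 in jk; rewrite -jk big_geq // mul0r add0r; apply: leA'.
have jd : (j < d)%N by lia.
have cjT := c_max _ jd; have bc : (b < c j)%N by rewrite /c; lia.
rewrite FS map_cons map_cat /= catrev_cat -catA big_ltn //.
rewrite -[phi_edge (b, c j)]/(phi b, phi (c j)) => leA'.
set e := (phi b, phi (c j)) in leA' *; set Ec := [seq _ | _ <- tree_edges _ _ _] in leA' *.
(* What the later children and [es] contribute, whether or not the walk is rerouted to the current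
   child. *)
set A1 := (\sum_(j.+1 <= i < d) i.+1%:R^-1) * (1 + tree_updates h) + A.
have Ec_tails e' : e' \in Ec -> exists2 i, (c j <= i < c j + T)%N & e'.1 = phi i.
  case/mapP=> e0 /tree_edges_bounds[? ? ?] ->; exists e0.1 => //.
  by apply/andP; split=> //; lia.
have phi_neq i i' : (i < i')%N -> (i' < b + tree_size d h.+1)%N -> phi i != phi i'.
  move=> ii' i'b; have i'n : (i' < n)%N by lia.
  apply/eqP => /(phi_inj (ltn_trans ii' i'n) i'n) Ei.
  by rewrite Ei ltnn in ii'.
have fresh_rcons i : (c j <= i < c j + T)%N -> phi i \notin rcons p (phi b).
  move=> ic; have ib : (b <= i < b + tree_size d h.+1)%N by lia.
  have bi : phi b != phi i by apply: phi_neq; lia.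
  by rewrite mem_rcons in_cons negb_or eq_sym bi; case: (fresh i ib).
have leA1 w'' : prefix (rcons p (phi b)) w'' -> size w'' = size w' ->
    A1 <= walk_updates K rule (catrev Ec (e :: g')) ([seq phi_edge e | e <- F j.+1 k] ++ es) x w''.
  move=> pw'' ww''; apply: IHk => //; last by rewrite ww''.
  - by lia.
  - rewrite out_deg_catrev ?out_deg_cons ?eqxx ?g'b // => e' /Ec_tails[i ic ->].
    by rewrite eq_sym phi_neq //; lia.
  - move=> i ic; rewrite cS in ic.
    rewrite out_deg_catrev => [|e' /Ec_tails[i' i'c ->]]; last by rewrite phi_neq //; lia.
    rewrite out_deg_cons /= (negbTE (phi_neq _ _ _ _)) ?g'0 //; lia.
(* Conditioning on the first coin: success gives one update, then the subtree of the child, then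
   [A1]; failure still gives [A1]. *)
have -> : (j.+1%:R^-1 + \sum_(j.+1 <= i < d) i.+1%:R^-1) * (1 + tree_updates h) + A =
    j.+1%:R^-1 * (1 + (tree_updates h + A1)) + (1 - j.+1%:R^-1) * A1 :> K.
  by rewrite /A1; ring.
apply: (@expect_update_walk_ge _ _ _ _ _ _ p) => //.
- by rewrite ww'; lia.
- by rewrite out_deg_cons eqxx g'b.
(* Success: the outer induction hypothesis, with [p] extended by the root and the later children as
   part of the continuation. *)
- move=> w'' pw'' ww''; rewrite lerD2l; apply: IHh pw'' _ _.
  + by rewrite -/T; lia.
  + move=> i; rewrite -/T => ic; split.
      exact: fresh_rcons.
    rewrite out_deg_cons /= (negbTE (phi_neq _ _ _ _)) ?g'0 //; lia.
  + by rewrite size_rcons ww'' ww'; lia.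
  + move=> w3 pw3 ww3; apply: leA1; last by rewrite ww3.
    exact: prefix_trans (prefix_rcons _ _) pw3.
(* Failure: the construction of the subtree of the child is skipped, as its edges leave nodes
   outside [rcons p (phi b)]. *)
- move=> w'' b' pw'' ww''; rewrite -[A1]add0r lerD ?ler0n //.
  apply: walk_updates_skip pw'' _ => [e' /Ec_tails[i ic ->]|w3 pw3 ww3].
    exact: fresh_rcons.
  by apply: leA1; rewrite // ww3.
Qed.

Lemma tree_updates_ge h : 1 <= harmonic_number K d ->
  harmonic_number K d ^+ h.+1 <= tree_updates h.+1.
Proof.
move=> H1; elim: h => [|h IHh]; first by rewrite /= addr0 mulr1.
rewrite exprS [tree_updates _]/=; apply: ler_wpM2l; first exact: le_trans H1.
by apply: le_trans IHh _; rewrite lerDr.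
Qed.

End WalkOnTree.

(** * From single walks to the sum over all initial stores *)

Section Truncation.
Variable K : realType.

(** The sum telescopes, as eps b^i = b^i - b^(i+1) for b = 1 - eps; [minn] covers the empty sum when
    [M <= L]. *)
Lemma sum_geometric_tail (eps : K) (L M : nat) :
  \sum_(i < M) eps * (1 - eps) ^+ i * (L <= i)%N%:R =
  (1 - eps) ^+ minn L M - (1 - eps) ^+ M.
Proof.
elim: M => [|M IHM]; first by rewrite big_ord0 minn0 subrr.
rewrite big_ord_recr /= IHM; case: (boolP (L <= M)%N) => LM.
  by rewrite (minn_idPl LM) (minn_idPl (leqW LM)) mulr1 exprS; ring.
rewrite -ltnNge in LM.
by rewrite (minn_idPr (ltnW LM)) (minn_idPr LM) !subrr mulr0 addr0.
Qed.

Lemma bernoulli_ineq (t : K) (k : nat) : 0 <= t <= 1 -> 1 - k%:R * t <= (1 - t) ^+ k.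
Proof.
case/andP=> t0 t1; elim: k => [|k IHk]; first by rewrite mul0r subr0.
rewrite exprS; apply: le_trans (_ : (1 - t) * (1 - k%:R * t) <= _).
  rewrite -natr1 -subr_ge0.
  by have -> : (1 - t) * (1 - k%:R * t) - (1 - (k%:R + 1) * t) = k%:R * (t * t);
    [ring | rewrite !mulr_ge0].
by apply: ler_wpM2l; rewrite ?subr_ge0.
Qed.

Lemma expr_small (b delta : K) : 0 <= b < 1 -> 0 < delta ->
  exists m, forall k, (m <= k)%N -> b ^+ k <= delta.
Proof.
case/andP=> b0 b1 d0.
have /cvgr0Pnorm_lt /(_ _ d0) [m _ mP] : ((GRing.exp b : K^nat) @ \oo --> (0 : K))%classic.
  by apply: cvg_expr; rewrite ger0_norm.
exists m => k mk; apply: ltW; apply: le_lt_trans (mP k mk); exact: ler_norm.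
Qed.

Variable V : finType.

(** Before any arrival all out-degrees are 0, so every move returns to the start and only the length
    of the walk is random. *)
Lemma walk_law_nseq (eps : K) (x : V) (l : nat) :
  walk_law eps [::] x (nseq l.+1 x) = eps * (1 - eps) ^+ l.
Proof.
rewrite /= eqxx mul1r; elim: l => [|l IHl] /=; first by rewrite expr0 mulr1.
rewrite IHl /prob /Defs.next /= /dret big_cons big_nil eqxx /= exprS; ring.
Qed.

Lemma expected_updates_ge_sum (R : nat) rule (eps : K) (es : seq (V * V)) (M : nat) :
  ((\sum_(l : {ffun V * 'I_R -> 'I_M})
     (\prod_k (eps * (1 - eps) ^+ l k)) *
     \sum_k walk_updates K rule [::] es k.1 (nseq (l k).+1 k.1))%:E
   <= expected_updates R rule eps es)%E.
Proof.
pose st (l : {ffun V * 'I_R -> 'I_M}) : store V R :=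
  [ffun k => nseq (l k).+1 k.1].
have st_inj : injective st.
  move=> l l' /ffunP ll'; apply/ffunP => k; apply: val_inj.
  by have := congr1 size (ll' k); rewrite !ffunE !size_nseq => -[].
apply: esum_ge; exists [set` [seq st l | l <- enum {ffun V * 'I_R -> 'I_M}]]%classic.
  by rewrite /fsets /=; split => //; exact: finite_seq.
rewrite -fsbig_seq /=; last by rewrite map_inj_uniq ?enum_uniq.
rewrite big_map big_enum /= sumEFin lee_fin ler_sum // => l _.
rewrite expect_run /store_law le_eqVlt; apply/orP; left; apply/eqP.
congr (_ * _); apply: eq_bigr => k _; rewrite ffunE //.
by rewrite walk_law_nseq.
Qed.

(** A walk from [S] is long enough with probability (1 - eps)^L. Truncating the lengths at [M] costs
    a factor 1/2 for this walk and another 1/2 for all the others together. *)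
Lemma expected_updates_ge (R : nat) rule (eps : K) (es : seq (V * V))
    (S : {set V}) (L : nat) (B : K) :
  0 < eps -> eps < 1 -> 0 <= B ->
  (forall x l, x \in S -> (L <= l)%N ->
     B <= walk_updates K rule [::] es x (nseq l.+1 x)) ->
  (((#|S| * R)%:R * ((1 - eps) ^+ L / 4 * B))%:E <= expected_updates R rule eps es)%E.
Proof.
move=> e0 e1 B0 leB; set b : K := 1 - eps.
have b01 : 0 <= b < 1 by rewrite /b subr_ge0 ltW //= ltrBlDr ltrDl.
have bp : 0 < b by rewrite subr_gt0.
pose D := #|{: V * 'I_R}|.
(* [m1] serves the first factor 1/2, and [m2] the second one through the Bernoulli inequality. *)
have [m1 m1P] : exists m, forall k, (m <= k)%N -> b ^+ k <= b ^+ L / 2.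
  by apply: expr_small; rewrite ?divr_gt0 ?exprn_gt0.
have [m2 m2P] : exists m, forall k, (m <= k)%N -> b ^+ k <= (2 * D.+1%:R)^-1.
  by apply: expr_small; rewrite ?invr_gt0 ?mulr_gt0.
pose M := (L + m1 + m2)%N.
have {m1P} M1 : b ^+ M <= b ^+ L / 2 by apply: m1P; rewrite /M; lia.
have {m2P} M2 : b ^+ M <= (2 * D.+1%:R)^-1 by apply: m2P; rewrite /M; lia.
have LM : (L <= M)%N by rewrite /M; lia.
have bM01 : 0 <= b ^+ M <= 1.
  by case/andP: b01 => ? ?; rewrite exprn_ge0 //= exprn_ile1 // ltW.
apply: le_trans (expected_updates_ge_sum R rule eps es M); rewrite lee_fin.
pose trunc : K := \sum_(l : {ffun V * 'I_R -> 'I_M})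
  \sum_(k in finset.setX S [set: 'I_R]%SET) (\prod_k' (eps * b ^+ l k')) * ((L <= l k)%N%:R * B).
apply: (@le_trans _ _ trunc); rewrite /trunc; last first.
  apply: ler_sum => l _; rewrite -big_distrr /=.
  apply: ler_wpM2l.
    by apply: prodr_ge0 => k _; rewrite mulr_ge0 ?exprn_ge0 // ltW.
  rewrite [leRHS](bigID (mem (finset.setX S [set: 'I_R]%SET))) /=.
  apply: ler_wpDr; first by apply: sumr_ge0 => k _; apply: walk_updates_ge0.
  apply: ler_sum => -[x i]; rewrite inE /= => /andP[xS _].
  case: leqP => Ll; first by rewrite mul1r leB.
  by rewrite mul0r walk_updates_ge0.
rewrite exchange_big /=.
have -> : (#|S| * R)%N = #|finset.setX S [set: 'I_R]%SET| by rewrite cardsX cardsT card_ord.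
rewrite mulrC mulr_natr -sumr_const; apply: ler_sum => k _.
under eq_bigr do rewrite mulrA.
rewrite -big_distrl /=; apply: ler_wpM2r => //.
(* The condition on the walk [k] becomes a factor for every walk, with threshold 0 for the others,
   so that the sum of products is a product of sums. *)
rewrite (eq_bigr (fun l : {ffun V * 'I_R -> 'I_M} =>
    \prod_k' (eps * b ^+ l k' * ((if k' == k then L else 0%N) <= l k')%N%:R))); last first.
  move=> l _; rewrite (bigD1 k) //= [in RHS](bigD1 k) //= eqxx mulrAC.
  congr (_ * _); apply: eq_bigr => k' /negbTE ->.
  by rewrite leq0n mulr1.
rewrite -(bigA_distr_bigA (fun k' (i : 'I_M) =>
   eps * b ^+ i * ((if k' == k then L else 0%N) <= i)%N%:R)) /= (bigD1 k) //= eqxx.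
rewrite sum_geometric_tail (minn_idPl LM) -/b.
rewrite (eq_bigr (fun=> 1 - b ^+ M)) => [|k' /negbTE ->]; last first.
  by rewrite sum_geometric_tail min0n expr0.
rewrite prodr_const.
set D' := #|_|; have D'D : (D' <= D)%N by apply: max_card.
have half : 2^-1 <= (1 - b ^+ M) ^+ D'.
  apply: le_trans (bernoulli_ineq _ bM01).
  have : D'%:R * b ^+ M <= D.+1%:R * (2 * D.+1%:R)^-1.
    by apply: ler_pM => //; [case/andP: bM01|rewrite ler_nat; lia].
  have -> : D.+1%:R * (2 * D.+1%:R)^-1 = 2^-1 :> K by rewrite invfM mulrCA divff ?mulr1 // pnatr_eq0.
  lra.
have -> : b ^+ L / 4 = b ^+ L / 2 * 2^-1 by field.
have bL : 0 <= b ^+ L by rewrite exprn_ge0 // ltW.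
by apply: ler_pM => //; lra.
Qed.

End Truncation.

(** * The graph and the walks that start outside its tree *)

Section Construction.
Variables (K : realType) (d h : nat).
Let T := tree_size d h.
Let n := (2 * T).-1.+1.

(* The tree occupies the nodes 0, ..., T - 1, and each of the T further nodes
   sends one edge to the root. *)
Definition broom_edges : seq (nat * nat) :=
  [seq ((T + i)%N, 0%N) | i <- iota 0 T] ++ tree_edges d h 0.

Definition broom_order : seq ('I_n * 'I_n) :=
  [seq phi_edge (@inord (2 * T).-1) e | e <- broom_edges].

Lemma broom_edges_bounds e : e \in broom_edges ->
  [/\ (e.1 < 2 * T)%N, (e.2 < 2 * T)%N & e.1 != e.2].
Proof.
have T0 : (0 < T)%N := tree_size_gt0 d h.
rewrite mem_cat => /orP[/mapP[i]|/tree_edges_bounds[e0 ee eT]].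
  by rewrite mem_iota => /andP[_ iT] -> /=; split; lia.
by rewrite -/T in eT; split; lia.
Qed.

Lemma uniq_broom_edges : uniq broom_edges.
Proof.
rewrite cat_uniq map_inj_uniq ?iota_uniq ?uniq_tree_edges => [|i j [/addnI]] //=.
(* Tree edges go to larger numbers, while the edges into the root go to 0. *)
rewrite andbT; apply/hasPn => e /tree_edges_bounds[_ ee _].
by apply/mapP => -[i _ Ee]; rewrite Ee in ee.
Qed.

Lemma inord_inj i j : (i < 2 * T)%N -> (j < 2 * T)%N ->
  inord i = inord j :> 'I_n -> i = j.
Proof. by move=> iT jT /(congr1 (@nat_of_ord _)); rewrite !inordK //; rewrite /n; lia. Qed.

Lemma uniq_broom_order : uniq broom_order.
Proof.
rewrite map_inj_in_uniq ?uniq_broom_edges // => -[i j] [i' j'].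
move=> /broom_edges_bounds[? ? _] /broom_edges_bounds[? ? _] [/inord_inj Ei /inord_inj Ej].
by rewrite Ei // Ej.
Qed.

Lemma size_broom_order : size broom_order = (n - 1)%N.
Proof.
have T0 : (0 < T)%N := tree_size_gt0 d h.
by rewrite size_map size_cat size_map size_iota size_tree_edges -/T /n; lia.
Qed.

Lemma loopless_broom_order e : e \in broom_order -> e.1 != e.2.
Proof.
case/mapP=> e' /broom_edges_bounds[? ? ee] -> /=.
by apply: contra_neq ee; apply: inord_inj.
Qed.

(** The walk stays at its start until its edge to the root arrives. The out-degree is then 1, so it
    is rerouted with certainty, and it meets the whole construction of the tree with beginning
    start, root. *)
Lemma walk_updates_broom rule i l : (i < T)%N -> (h < l)%N ->
  tree_updates K d h <=
  walk_updates K rule [::] broom_order (inord (T + i)) (nseq l.+1 (inord (T + i))).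
Proof.
move=> iT hl; set x : 'I_n := inord (T + i); pose phi := @inord (2 * T).-1.
have T0 : (0 < T)%N := tree_size_gt0 d h.
pose src j k := [seq phi_edge phi e | e <- [seq ((T + i)%N, 0%N) | i <- iota j k]].
have srcP j k e : (j + k <= T)%N -> e \in src j k ->
    exists2 i', (j <= i' < j + k)%N & e.1 = phi (T + i')%N.
  by move=> jk /mapP[_ /mapP[i' i'P ->] ->]; exists i'; rewrite // -mem_iota.
have phi_neq i1 i2 : (i1 < 2 * T)%N -> (i2 < 2 * T)%N -> i1 != i2 -> phi i1 != phi i2.
  by move=> ? ?; apply: contra_neq; apply: inord_inj.
have -> : broom_order = src 0%N i ++ (x, phi 0%N) :: (src i.+1 (T - i.+1)%N ++
    [seq phi_edge phi e | e <- tree_edges d h 0]).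
  have iota_i : iota 0 T = iota 0 i ++ i :: iota i.+1 (T - i.+1).
    by rewrite -[in LHS](subnKC (ltnW iT)) iotaD -(subnSK iT).
  by rewrite /broom_order /broom_edges iota_i !map_cat -catA.
apply: (@walk_updates_skip _ _ _ _ _ _ _ _ [:: x]); rewrite /= ?eqxx ?prefix0s //.
  move=> e /srcP [|i' i'i ->]; first by lia.
  by rewrite inE phi_neq //; lia.
move=> w xw; rewrite size_nseq => wl.
have -> : tree_updates K d h = 1%:R^-1 * tree_updates K d h + (1 - 1%:R^-1) * 0.
  by rewrite invr1; ring.
apply: (@expect_update_walk_ge _ _ _ _ _ _ [::]) => //; first by rewrite wl /=; lia.
- rewrite out_deg_cons eqxx out_deg_catrev // => e /srcP [|i' i'i ->]; first by lia.
  by rewrite phi_neq //; lia.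
- move=> w' pw' ww' /=; apply: ler_wpDl => //.
  apply: walk_updates_skip pw' _ => [e /srcP [|i' i'i ->]|w'' pw'' ww'']; first by lia.
    by rewrite !inE negb_or !phi_neq //; lia.
  rewrite -[tree_updates _ _ _]addr0 -[X in walk_updates _ _ _ X]cats0.
  apply: (@walk_updates_tree _ _ _ (2 * T) _ _ _ _ _ _ _ _ _ [:: x]) => //.
  + exact: inord_inj.
  + by rewrite -/T; lia.
  + move=> j; rewrite -/T => jT; split; first by rewrite inE phi_neq //; lia.
    rewrite out_deg_catrev => [|e /srcP [|i' i'i ->]]; [|by lia|by rewrite phi_neq //; lia].
    rewrite out_deg_cons (negbTE (phi_neq _ _ _ _ _)); try lia.
    rewrite out_deg_catrev => [|e /srcP [|i' i'i ->]] //; first by lia.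
    by rewrite phi_neq //; lia.
  + by rewrite ww'' ww' wl /=; lia.
- by move=> w' b _ _; rewrite addr_ge0 ?walk_updates_ge0.
Qed.

End Construction.

(** * Choice of the constant and comparison of the exponents *)

Lemma powR_logb (K : realType) (b x : K) : 1 < b -> 0 < x -> b `^ logb b x = x.
Proof.
move=> b1 x0; have b0 : 0 < b by apply: lt_trans b1.
by rewrite /powR gt_eqF // /logb divfK ?lnK // gt_eqF // ln_gt0.
Qed.

Theorem theorem2 (K : realType) (rule : coin_rule) (eps : K) (d : nat)
  (eps_gt0 : 0 < eps) (eps_lt1 : eps < 1) (d_ge2 : (2 <= d)%N)
  (Hd : 1 < harmonic_number K d * (1 - eps)) :
  exists2 c : K, 0 < c &
    forall R : nat, (1 <= R)%N ->
    forall N : nat, exists n : nat, (N <= n)%N /\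
    exists (G : {set 'I_n * 'I_n}) (es : seq ('I_n * 'I_n)),
      [/\ loopless G, #|G| = (n - 1)%N, arrival_order G es &
        ((c * R%:R * n%:R *
           #|G|%:R `^ logb d%:R (harmonic_number K d * (1 - eps)))%:E
         <= expected_updates R rule eps es)%E].
Proof.
set H := harmonic_number K d in Hd *; set a := H * (1 - eps) in Hd *.
set gamma := logb _ _.
have b0 : 0 < 1 - eps by rewrite subr_gt0.
have d1 : 1 < d%:R :> K by rewrite ltr1n.
have a0 : 0 < a by apply: lt_trans Hd.
have H1 : 1 <= H.
  rewrite ltW //; apply: lt_le_trans Hd _; rewrite /a ler_piMr ?lerBlDr ?lerDl ?ltW //.
  by rewrite -(pmulr_lgt0 _ b0).
have gamma0 : 0 <= gamma by rewrite divr_ge0 ?ln_ge0 ?ltW.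
have c4 : 0 < 4 `^ gamma :> K by rewrite powR_gt0.
(* The 8 combines the 4 of [expected_updates_ge] with T = n/2; 1 - eps is left over from (1 -
   eps)^(h+1) H^h; and 4^gamma pays for m = 2T - 1 <= 4 d^h. *)
exists ((1 - eps) / 8 / 4 `^ gamma); first by rewrite !divr_gt0.
(* The height is positive, as [tree_updates_ge] requires, and h < T makes n exceed N. *)
move=> R _ N; pose h := N.+1; pose T := tree_size d h.
have hT : (h < T)%N by apply: tree_size_ge.
have T0 : (0 < T)%N := tree_size_gt0 d h.
have T2 : (T < 2 * d ^ h)%N by apply: tree_size_le.
have nT : (2 * T).-1.+1 = (2 * T)%N by rewrite prednK // muln_gt0.
exists (2 * T).-1.+1; split; first by rewrite nT /h in hT *; lia.
pose es := broom_order d h.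
have es_card : #|[set:: es]| = ((2 * T).-1.+1 - 1)%N.
  by rewrite cardsE (card_uniqP (uniq_broom_order d h)) size_broom_order.
exists [set:: es]%SET, es; split => //.
- by apply/forallP => x; rewrite finset.in_set; apply/negP => /loopless_broom_order /eqP.
- apply: uniq_perm; rewrite ?uniq_broom_order ?enum_uniq // => e.
  by rewrite mem_enum finset.in_set.
rewrite es_card.
pose S : {set 'I_(2 * T).-1.+1} := [set inord (T + i) | i : 'I_T]%SET.
have cardS : #|S| = T.
  rewrite card_imset ?card_ord // => i j /inord_inj ij; apply: val_inj.
  by apply/(@addnI T)/ij; have := ltn_ord i; have := ltn_ord j; rewrite -/T; lia.
have Hh : H ^+ h <= tree_updates K d h by apply: tree_updates_ge.
have Hh0 : 0 <= H ^+ h by rewrite exprn_ge0 // (le_trans _ H1).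
have := @expected_updates_ge K _ R rule eps es S h.+1 (H ^+ h) eps_gt0 eps_lt1 Hh0.
move=> /(_ _) le_exp; apply: le_trans (le_exp _); last first.
  move=> x l /imsetP[i _ ->] hl; apply: le_trans Hh _.
  exact: walk_updates_broom.
rewrite lee_fin cardS nT [(T * R)%:R]natrM.
have -> : T%:R * R%:R * ((1 - eps) ^+ h.+1 / 4 * H ^+ h) =
    (1 - eps) / 8 / 4 `^ gamma * R%:R * (2 * T)%:R * (4 `^ gamma * a ^+ h) :> K.
  by rewrite natrM /a exprMn exprS; field; rewrite gt_eqF.
apply: ler_wpM2l; first by rewrite !mulr_ge0 ?invr_ge0 // ltW.
(* By the choice of [gamma], d^gamma = a. *)
have -> : a ^+ h = (d%:R ^+ h) `^ gamma.
  by rewrite -[d%:R ^+ h]powR_mulrn // powRAC powR_logb // powR_mulrn // ltW.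
rewrite -powRM ?exprn_ge0 //; apply: ge0_ler_powR => //; rewrite ?nnegrE ?mulr_ge0 ?exprn_ge0 //.
by rewrite -natrX -natrM ler_nat; lia.
Qed.
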